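(* Let $\mathcal{C}_k^\star$ with $\star\in\{d_\Delta,s_\Delta\}$ be a $(k,\Delta)$-core (if $\star=d_\Delta$) or a $(k,\Delta)$-truss (if $\star=s_\Delta$) of a temporal graph $\mathcal{G}=(V,\mathcal{E})$, where $k,\Delta\in\mathbb{N}$. The $\Delta$-connected components of $\mathcal{C}_k^\star$ are non-inclusion-maximal $(k,\Delta)$-cores or $(k,\Delta)$-trusses, respectively.
   Context: A temporal graph $\mathcal{G}=(V,\mathcal{E})$ consists of a finite set $V$ of nodes and a finite set $\mathcal{E}$ of undirected temporal edges $e=(\{u,v\},t)$ with $u,v\in V$, $u\ne v$, and timestamp $t\in\mathbb{N}$. For $\mathcal{E}'\subseteq\mathcal{E}$ the edge-induced subgraph is $(V',\mathcal{E}')$ with $V'$ the set of endpoints of edges in $\mathcal{E}'$. For $\Delta\in\mathbb{N}$, $e=(\{u,v\},t)\in\mathcal{E}$ and $\mathcal{E}'\subseteq\mathcal{E}$, the $\Delta$-degree is $$d_\Delta(e,\mathcal{E}')=\min\big(|\{(\{u,w\},t')\in\mathcal{E}' : |t-t'|\le\Delta\}|,\ |\{(\{v,w\},t')\in\mathcal{E}' : |t-t'|\le\Delta\}|\big)$$ and the $\Delta$-support is $$s_\Delta(e,\mathcal{E}')=|\{\{e_i,e_j\} : e_i=(\{u,w\},t_1),\ e_j=(\{v,w\},t_2)\in\mathcal{E}' \text{ with } u\ne v\ne w,\ |t-t_1|\le\Delta,\ |t-t_2|\le\Delta \text{ and } |t_1-t_2|\le\Delta\}|.$$ Two edges $(\{u,v\},t)$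 and $(\{u,w\},t')$ with $|t-t'|\le\Delta$ are called $\Delta$-incident. For $\star\in\{d_\Delta,s_\Delta\}$, $\mathcal{C}^\star_k$ is the inclusion-maximal edge-induced subgraph of $\mathcal{G}$, with edge set $\mathcal{F}$, such that $\star(e,\mathcal{F})\ge k$ for all $e\in\mathcal{F}$; it is called a $(k,\Delta)$-core for $\star=d_\Delta$ and a $(k,\Delta)$-truss for $\star=s_\Delta$. A non-inclusion-maximal $(k,\Delta)$-core (respectively $(k,\Delta)$-truss) is an edge-induced subgraph, with edge set $\mathcal{F}$, that satisfies the condition $d_\Delta(e,\mathcal{F})\ge k$ (respectively $s_\Delta(e,\mathcal{F})\ge k$) for all $e\in\mathcal{F}$ but is not inclusion-maximal with this property. A $\Delta$-walk in a temporal graph is a sequence of $\ell\in\mathbb{N}$ temporal edges $(e_1=(\{v_1,v_2\},t_1),e_2=(\{v_2,v_3\},t_2),\dots,e_\ell=(\{v_\ell,v_{\ell+1}\},t_\ell))$ for which $|t_i-t_{i+1}|\le\Delta$ for all $1\le i<\ell$, i.e., $e_i$ and $e_{i+1}$ are $\Delta$-incident. An edge $e_j$ is $\Delta$-reachable from an edge $e_i$ if there exists a $\Delta$-walk from $e_i$ to $e_j$; this is an equivalence relation on the edges. The $\Delta$-connected components of a temporal graph (or of a subgraph such as a $(k,\Delta)$-core or $(k,\Delta)$-truss) are the maximal subsets of its temporal edges such that all edges in the subset are pairwise $\Delta$-reachable.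
   Formalization: Every component is shown to satisfy the core/truss condition, but it is claimed not inclusion-maximal only when it differs from the whole core/truss: if that is itself Δ-connected (e.g. a single edge, k = 1, degree), its only component is itself, which is inclusion-maximal. *)

(* Defs.v *)
From mathcomp Require Import all_boot ssrint finmap.

Set Implicit Arguments.
Unset Strict Implicit.
Unset Printing Implicit Defensive.

Local Open Scope fset_scope.
Local Open Scope nat_scope.

Definition tedge (V : finType) : choiceType := ({set V} * nat)%type.

Definition edge (V : finType) (u v : V) (t : nat) : tedge V := ([set u; v], t).

(* Timestamps are unbounded, so the finite edge set is an [fset]. *)
Record temporal_graph (V : finType) := TemporalGraph {
  edges :> {fset tedge V};
  edgesP : forall e, e \in edges ->
    exists u v t, u != v /\ e = edge u v t
}.

(* |s - t| <= Delta *)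
Definition close (Delta s t : nat) : bool := `|s - t|%N <= Delta.

Section Measures.
Variables (V : finType) (Delta : nat).
Implicit Types (u v w : V) (t : nat) (F : {fset tedge V}).

Definition incident_edges u t F : {fset tedge V} :=
  [fset f in F | [exists w, f.1 == [set u; w]] && close Delta t f.2].

(* The measures take an edge as its endpoints u, v and its time t; both are
   symmetric in u and v. If the edge lies in F, it is itself counted at each of
   its two endpoints. *)
Definition ddegree u v t F : nat :=
  minn #|` incident_edges u t F| #|` incident_edges v t F|.

Definition triangle_sides u v t (ei ej : tedge V) : bool :=
  [exists w, [&& u != v, v != w, u != w,
                 ei.1 == [set u; w] & ej.1 == [set v; w]]]
  && [&& close Delta t ei.2, close Delta t ej.2 & close Delta ei.2 ej.2].

(* Counts unordered pairs {ei, ej}. *)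
Definition dsupport u v t F : nat :=
  #|` [fset [fset ei; ej] | ei in F, ej in F & triangle_sides u v t ei ej] |.

End Measures.

Variant measure := Degree | Support.

Definition measure_val (star : measure) :=
  match star with Degree => ddegree | Support => dsupport end.

(* An edge-induced subgraph (V', F) is determined by its edge set F, its node
   set V' being the set of endpoints of F; it is represented by F, and inclusion
   of such subgraphs is inclusion of edge sets. *)
Section Cores.
Variables (V : finType) (G : temporal_graph V) (star : measure).
Variables (k Delta : nat).
Implicit Types F H : {fset tedge V}.

(* F is a subgraph of G in which every edge e satisfies star(e, F) >= k. *)
Definition k_cohesive F : Prop :=
  F `<=` G /\
  forall u v t, edge u v t \in F -> k <= measure_val star Delta u v t F.

Definition inclusion_maximal (P : {fset tedge V} -> Prop) F : Prop :=
  P F /\ forall H, P H -> F `<=` H -> H = F.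

(* The (k, Delta)-core for [Degree], the (k, Delta)-truss for [Support]. *)
Definition core_or_truss F : Prop := inclusion_maximal k_cohesive F.

Definition non_maximal_core_or_truss F : Prop :=
  k_cohesive F /\ ~ inclusion_maximal k_cohesive F.

End Cores.

Section Components.
Variables (V : finType) (Delta : nat).
Implicit Types (F D : {fset tedge V}) (e f : tedge V).

(* The i-th edge of the walk, 0 <= i < l, is ({v i, v (i + 1)}, t i); the values
   v i for i > l and t i for i >= l are irrelevant. *)
Definition delta_walk F (l : nat) (v : nat -> V) (t : nat -> nat) : Prop :=
  (forall i, i < l -> edge (v i) (v i.+1) (t i) \in F) /\
  (forall i, i.+1 < l -> close Delta (t i) (t i.+1)).

Definition reachable F e f : Prop :=
  exists (l : nat) (v : nat -> V) (t : nat -> nat),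
    [/\ 0 < l, delta_walk F l v t, e = edge (v 0) (v 1) (t 0)
      & f = edge (v l.-1) (v l) (t l.-1)].

(* Walks run inside the whole subgraph F, not inside the component. *)
Definition connected_component F D : Prop :=
  inclusion_maximal (fun D' : {fset tedge V} =>
    D' `<=` F /\ forall e f, e \in D' -> f \in D' -> reachable F e f) D.

End Components.

(* Main.v *)
(** Every edge of [C] that is [Delta]-incident to an edge of a component [D]
    lies in [D]. The edges counted by the degree or the support of an edge of
    [D] in [C] are all [Delta]-incident to it, so the measures computed in [C]
    and in [D] agree. *)

Require Import Defs.
From mathcomp Require Import all_boot ssrint finmap.

Set Implicit Arguments.
Unset Strict Implicit.
Unset Printing Implicit Defensive.

Local Open Scope fset_scope.
Local Open Scope nat_scope.

Lemma close_refl Delta t : close Delta t t.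
Proof. by rewrite /close distnn. Qed.

Lemma close_sym Delta s t : close Delta s t = close Delta t s.
Proof. by rewrite /close distnC. Qed.

Lemma edgeC (V : finType) (u v : V) t : edge u v t = edge v u t.
Proof. by rewrite /edge setUC. Qed.

Lemma edge_eta (V : finType) (f : tedge V) (u v : V) :
  f.1 = [set u; v]%SET -> f = edge u v f.2.
Proof. by case: f => A t /= ->. Qed.

Section Reachability.
Variables (V : finType) (Delta : nat) (F : {fset tedge V}).
Implicit Types (e f : tedge V) (x y z : V) (s : nat).

(** A walk that traverses its last edge from [x] to [y]. [reachable] forgets this orientation
    because edges are unordered, but only the final vertex [y] allows an extension. *)
Definition walk_to e x y s : Prop :=
  exists l v t, [/\ delta_walk Delta F l.+1 v t, e = edge (v 0) (v 1) (t 0),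
                    v l = x, v l.+1 = y & t l = s].

Lemma reachableP e f :
  reachable Delta F e f <->
  exists x y s, f = edge x y s /\ walk_to e x y s.
Proof.
split=> [[[|l] [v [t [// _ vt ef ff]]]]|].
  by exists (v l), (v l.+1), (t l); split=> //; exists l, v, t; split.
move=> [x [y [s [-> [l [v [t [vt ef <- <- <-]]]]]]]].
by exists l.+1, v, t; split.
Qed.

Lemma walk_to_mem e x y s : walk_to e x y s -> edge x y s \in F.
Proof. by move=> [l [v [t [[vF _] _ <- <- <-]]]]; apply: vF. Qed.

Lemma walk_to_step e x y s z s' :
  walk_to e x y s -> edge y z s' \in F -> close Delta s s' ->
  walk_to e y z s'.
Proof.
move=> [l [v [t [[vF tc] -> _ <- <-]]]] yzF ss'.
(* The old walk has vertices up to index [l.+1] but times only up to [l], hence the two different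
   cut-offs. *)
exists l.+1, (fun i => if i <= l.+1 then v i else z),
  (fun i => if i <= l then t i else s').
split; rewrite ?leqnn ?ltnn //; split=> i.
  rewrite ltnS => il; have [lti|] := leqP i l; first by rewrite ltnS lti leqW // vF.
  move=> lti; have /eqP -> : i == l.+1 by rewrite eqn_leq il lti.
  by rewrite leqnn ltnn.
rewrite !ltnS => il; rewrite il; have [lti|] := ltnP i l; first exact: tc.
by move=> li; have /eqP -> : i == l; first rewrite eqn_leq il.
Qed.

Lemma reachable_refl e x y s : e = edge x y s -> e \in F -> reachable Delta F e e.
Proof.
move=> -> eF; exists 1, (fun i => if i is 0 then x else y), (fun=> s).
by split=> //; split=> [[|i]|i].
Qed.

Lemma reachable_sym e f : reachable Delta F e f -> reachable Delta F f e.
Proof.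
move=> [[|l] [v [t [// _ [vF tc] -> ->]]]].
(* With [l.+1] edges there is one more vertex than times, so the two sequences are reversed about
   different indices. *)
exists l.+1, (fun i => v (l.+1 - i)), (fun i => t (l - i)).
split=> //; rewrite /= ?subn0 ?subSS ?subn0 ?subnn ?subSnn 1?edgeC //.
split=> i; rewrite ltnS => il.
  by rewrite subSS subSn // edgeC vF // ltnS leq_subr.
by rewrite close_sym -(subnSK il) tc // subnSK // ltnS leq_subr.
Qed.

(* A walk may arrive at the endpoint of its last edge opposite to [a]; it then
   traverses this edge once more, backwards. *)
Lemma reachable_incident e x y s a z s' :
  reachable Delta F e (edge x y s) -> a \in [set x; y]%SET ->
  edge a z s' \in F -> close Delta s s' -> reachable Delta F e (edge a z s').
Proof.
move=> /reachableP[x' [y' [s1 [[-> <-] w]]]] axy aF ss'.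
apply/reachableP; exists a, z, s'; split=> //.
move: axy; rewrite !inE => /orP[]/eqP a_eq; subst a; last exact: walk_to_step w _ _.
have backF := walk_to_mem w; rewrite edgeC in backF.
exact: walk_to_step (walk_to_step w backF (close_refl _ _)) aF ss'.
Qed.

End Reachability.

Section Components.
Variables (V : finType) (Delta : nat) (F D : {fset tedge V}).
Hypothesis comp_D : connected_component Delta F D.

(** Every edge of [D] reaches [edge u v t] and, one step further, the incident edge [f]. Hence
    adding [f] to [D] preserves pairwise reachability, and maximality gives that [D] already
    contains [f]. *)
Lemma component_incident u v t a w s :
  edge u v t \in D -> a \in [set u; v]%SET -> edge a w s \in F ->
  close Delta t s -> edge a w s \in D.
Proof.
case: comp_D => -[DF reachD] maxD eD auv fF ts; set f := edge a w s in fF *.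
have reachf g : g \in D -> reachable Delta F g f.
  by move=> gD; apply: reachable_incident (reachD _ _ gD eD) auv fF ts.
rewrite -(maxD (f |` D)) ?fset1U1 ?fsubsetU1 //.
split=> [|g h]; first by rewrite fsubUset fsub1set fF.
rewrite !inE => /orP[/eqP->|gD] /orP[/eqP->|hD].
- exact: reachable_refl (erefl f) fF.
- exact: reachable_sym (reachf _ hD).
- exact: reachf.
- exact: reachD.
Qed.

Lemma component_incident_edges u v t a :
  edge u v t \in D -> a \in [set u; v]%SET ->
  incident_edges Delta a t F `<=` incident_edges Delta a t D.
Proof.
move=> eD auv; apply/fsubsetP => f; rewrite !inE /=.
case/and3P=> fF /existsP[w /eqP fw] tf; apply/and3P; split=> //.
  by rewrite (edge_eta fw) in fF *; apply: component_incident eD auv fF tf.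
by apply/existsP; exists w; apply/eqP.
Qed.

Lemma component_ddegree u v t :
  edge u v t \in D -> ddegree Delta u v t F <= ddegree Delta u v t D.
Proof.
move=> eD; rewrite /ddegree leq_min !geq_min.
(* Counts are compared at the same endpoint: the first disjunct settles [u], the second settles
   [v]. *)
by rewrite !(fsubset_leq_card (component_incident_edges eD _)) ?set21 ?set22 ?orbT.
Qed.

Lemma component_dsupport u v t :
  edge u v t \in D -> dsupport Delta u v t F <= dsupport Delta u v t D.
Proof.
move=> eD; apply: fsubset_leq_card; apply/fsubsetP => p.
case/imfset2P=> ei /= eiF [ej]; rewrite !inE /= => /andP[ejF tri] ->.
(* The side [ei] meets the edge at [u] and [ej] meets it at [v]; with [ti] and [tj], both are
   incident to an edge of [D]. *)
have /andP[/existsP[w /and5P[_ _ _ /eqP eiw /eqP ejw]] /and3P[ti tj _]] := tri.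
apply/imfset2P; exists ei => /=.
  by rewrite (edge_eta eiw) in eiF *; apply: component_incident eD (set21 _ _) eiF ti.
exists ej => //; rewrite !inE /= tri andbT.
by rewrite (edge_eta ejw) in ejF *; apply: component_incident eD (set22 _ _) ejF tj.
Qed.

End Components.

(** A [Delta]-connected [C] is its own only component and is maximal, so non-maximality is asserted
    for [D <> C]. *)
Theorem theorem6 (V : finType) (G : temporal_graph V) (star : measure)
    (k Delta : nat) (C : {fset tedge V})
    (hC : core_or_truss G star k Delta C)
    (D : {fset tedge V}) (hD : connected_component Delta C D) :
  k_cohesive G star k Delta D /\
  (D <> C -> non_maximal_core_or_truss G star k Delta D).
Proof.
have [[CG kC] _] := hC; have [[DC _] _] := hD.
have kD : k_cohesive G star k Delta D.
  split=> [|u v t eD]; first exact: fsubset_trans DC CG.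
  apply: leq_trans (kC _ _ _ (fsubsetP DC _ eD)) _.
  by case: star {hC kC}; [apply: component_ddegree | apply: component_dsupport].
split=> // DnC; split=> // -[_ maxD]; apply: DnC.
(* [C] itself is a cohesive superset of [D], so a maximal [D] would equal [C]. *)
by rewrite (maxD C (conj CG kC) DC).
Qed.
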